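(* Let $q,a\in\mathbb{C}$ with $|q|<1$ and $|a|<1$. Let $f(n)=\sum_{k\ge0}c_kn^k\in\mathbb{Q}[n]$ be a polynomial with $af(1)=0$, and define $t_0(a,q)=0$ and, for $n\ge1$, $$t_n(a,q)=\frac{f(n)-af(n+1)}{1-aq^n} + \frac{1-q^{n-1}}{1-aq^n}\,t_{n-1}(a,q).$$ Then $$\lim_{\ell \rightarrow \infty} \left( \sum_{n=1}^\ell f(n) - \frac{a}{1-a}f(\ell+1) - \frac{1-aq^\ell}{1-a}\, t_\ell(a,q) \right) = \sum_{j=1}^\infty h_j P_j(a,q),$$ where $h_1=c_0$ and, for $j\ge2$, $h_j=\sum_{i\ge j-1}(-1)^{i-j+1}\binom{i-1}{j-2}\, i!\sum_{k\ge i}c_k\tilde{s}(k,i)$, and $$P_j(a,q)=-\sum_{n=1}^\infty\frac{(q/a)_na^n}{(1-q^n)^j(q)_n}.$$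
   Context: For $x\in\mathbb{C}$: $(x)_0=1$, $(x)_n=(1-x)(1-xq)\cdots(1-xq^{n-1})$; here $(q/a)_na^n$ means $\prod_{i=1}^n(a-q^i)$. $\tilde{s}(k,i)$ denotes the Stirling numbers of the second kind. (Only finitely many $h_j$ are nonzero since $f$ is a polynomial.) *)

(* Defs.v *)
From mathcomp Require Import all_boot all_order all_algebra.
From mathcomp Require Import complex.
From mathcomp Require Import all_classical all_reals all_analysis.

Set Implicit Arguments.
Unset Strict Implicit.
Unset Printing Implicit Defensive.

Import Order.TTheory GRing.Theory Num.Theory.
Import numFieldNormedType.Exports.

Local Open Scope ring_scope.
Local Open Scope classical_set_scope.

(* Stirling numbers of the second kind, by their standard recurrence
   S(n+1, k+1) = (k+1) S(n, k+1) + S(n, k). *)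
Fixpoint stirling2 (n k : nat) : nat :=
  match n, k with
  | 0, 0 => 1
  | 0, _.+1 => 0
  | _.+1, 0 => 0
  | n'.+1, k'.+1 => (k'.+1 * stirling2 n' k'.+1 + stirling2 n' k')%N
  end.

(* Since f`_k = 0 for k >= size f, the sums over i >= j - 1 and k >= i are
   truncated at size f. The value at j = 0 is never used. *)
Definition hcoef (f : {poly rat}) (j : nat) : rat :=
  if j == 1%N then f`_0 else
  \sum_(j.-1 <= i < size f)
    (-1) ^+ (i.+1 - j) * ('C(i.-1, j - 2))%:R * (i`!)%:R *
    \sum_(i <= k < size f) f`_k * (stirling2 k i)%:R.

(* The complex numbers as a numFieldType: MathComp-Analysis equips the carrier
   of any numFieldType with the topology of its norm, but declares no topology
   on R[i] itself. *)
Definition complexField (R : realType) : numFieldType := R[i].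

Section QSeries.
Context {C : numFieldType}.
Implicit Types (q a x : C) (f : {poly rat}) (n j : nat).

Definition polyval f n : C := ratr f.[n%:R].

Definition qpoch x q n : C := \prod_(0 <= i < n) (1 - x * q ^+ i).

(* (q/a)_n a^n, read as a polynomial in a so that a = 0 is allowed. *)
Definition qpoch_div q a n : C := \prod_(1 <= i < n.+1) (a - q ^+ i).

Fixpoint tseq f a q n : C :=
  if n is m.+1 then
    (polyval f n - a * polyval f n.+1) / (1 - a * q ^+ n)
    + (1 - q ^+ m) / (1 - a * q ^+ n) * tseq f a q m
  else 0.

Definition P_term j a q n : C :=
  qpoch_div q a n / ((1 - q ^+ n) ^+ j * qpoch q q n).

Definition P_partial j a q : C^nat := fun N => \sum_(1 <= n < N.+1) P_term j a q n.

Definition P_fun j a q : C := - limn (P_partial j a q).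

Definition hP_partial f a q : C^nat :=
  fun N => \sum_(1 <= j < N.+1) ratr (hcoef f j) * P_fun j a q.

End QSeries.

(* Main.v *)
Require Import Defs.
From mathcomp Require Import all_boot all_order all_algebra.
From mathcomp Require Import complex ring.
From mathcomp Require Import all_classical all_reals all_analysis.
Import Order.TTheory GRing.Theory Num.Theory.
Import numFieldNormedType.Exports.
Local Open Scope ring_scope.
Local Open Scope classical_set_scope.

(** With [T z = sum_n t_n z^n], the bracketed quantity at [l] telescopes to the
    partial sum of [T q] over [n < l]. The recurrence for [t_n] and [a f(1) = 0]
    give the functional equation [(1 - z) T(z) = (a - z) (T(q z) - G(z))], where
    [G(z) = sum_n f(n + 1) z^n] equals [sum_j h_j / (1 - z)^j]. Iterating it along
    [z = q, q^2, q^3, ...] writes [T q] as minus the sum over [m >= 1] of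
    [W_m G(q^m)], where [W_m = (q/a)_m a^m / (q)_m] tends to [0], and this is
    [sum_j h_j P_j]. *)

(** * Stirling numbers and the expansion of [f(n + 1)] in the binomials ['C(n + s, s)] *)

Lemma stirling2_small k i : (k < i)%N -> stirling2 k i = 0%N.
Proof.
elim: k i => [|k IH] [|i] //= ki.
by rewrite !IH ?muln0 // ltnW.
Qed.

Lemma muln_ffact n i : (n * n ^_ i = n ^_ i.+1 + i * n ^_ i)%N.
Proof.
rewrite ffactnSr; have [ni|ni] := leqP i n.
  by rewrite (mulnC i) -mulnDr subnK // mulnC.
by rewrite ffact_small // !(muln0, mul0n).
Qed.

(** Multiplying a falling factorial by [n] reproduces the recurrence of [stirling2]. The bound [m]
    is free so that [size f] can serve all exponents at once. *)
Lemma expn_stirling2 n k m : (k < m)%N ->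
  (n ^ k = \sum_(i < m) stirling2 k i * n ^_ i)%N.
Proof.
elim: k m => [|k IH] [//|m] km.
  by rewrite big_ord_recl /= big1.
(* Index shift by one: the term at [0] carries the factor [0], and the term at [m] vanishes because
   [k < m]. *)
have dE : (\sum_(i < m) stirling2 k i * (i * n ^_ i) =
           \sum_(i < m) stirling2 k i.+1 * (i.+1 * n ^_ i.+1))%N.
  have := @big_ord_recr nat 0%N addn m (fun i : 'I_m.+1 => stirling2 k i * (i * n ^_ i))%N.
  rewrite big_ord_recl /= (stirling2_small k m km) mul0n mul0n muln0 add0n addn0.
  by move=> <-; apply: eq_bigr => i _; rewrite /bump /= add1n.
rewrite expnS (IH m) // big_ord_recl /= mul0n add0n big_distrr /=.
under eq_bigr => i _ do rewrite mulnCA muln_ffact mulnDr.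
rewrite big_split /= dE -big_split /=; apply: eq_bigr => i _.
rewrite /bump /= add1n mulnDl addnC; congr (_ + _)%N.
by rewrite mulnCA mulnA.
Qed.

(** This is an [i]-th finite difference of binomials. The offset [p] makes the induction go through:
    Pascal's rule on ['C(i.+1, s)] yields minus the sum for [(i, p)] plus the sum for
    [(i, p + 1)]. *)
Lemma sum_signed_bin (n i p : nat) :
  \sum_(s < i.+1) (-1) ^+ (i - s) * 'C(i, s)%:R * 'C(n + s + p, s + p)%:R
  = 'C(n + p, i + p)%:R :> rat.
Proof.
elim: i p => [|i IH] p; first by rewrite big_ord1 subnn bin0 addn0 add0n !mul1r.
rewrite big_ord_recl /= !bin0.
under eq_bigr => s _ do
  rewrite /bump /= add1n subSS binS natrD mulrDr mulrDl.
rewrite big_split /= addrA.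
set X := (X in X + _).
have {X}-> : X = - 'C(n + p, i + p)%:R.
  rewrite /X -IH big_ord_recr /= [in RHS]big_ord_recl /=.
  rewrite (bin_small (ltnSn i)) mulr0 mul0r addr0 opprD subn0 bin0 subn0 exprS -sumrN.
  congr (_ + _); first by ring.
  apply: eq_bigr => s _; rewrite /bump /= add1n.
  by rewrite -(subnSK (ltn_ord s)) exprS; ring.
rewrite [X in _ + X](_ : _ = 'C(n + p.+1, i + p.+1)%:R); last first.
  by rewrite -IH; apply: eq_bigr => s _; rewrite !addnS !addSn.
by rewrite !addnS addSn binS natrD; ring.
Qed.

(** The coefficient of the falling factorial [n ^_ i] in [f]. *)
Definition stirling_coef (f : {poly rat}) (i : nat) : rat :=
  \sum_(i <= k < size f) f`_k * (stirling2 k i)%:R.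

Lemma stirling_coef_full f i :
  stirling_coef f i = \sum_(0 <= k < size f) f`_k * (stirling2 k i)%:R.
Proof.
rewrite /stirling_coef (@big_nat_widenl _ _ _ i 0) // big_mkcond /=.
apply: eq_bigr => k _; case: leqP => // ki.
by rewrite stirling2_small // mulr0.
Qed.

Lemma horner_stirling_coef f n :
  f.[n%:R] = \sum_(0 <= i < size f) stirling_coef f i * (i`!)%:R * 'C(n, i)%:R.
Proof.
under eq_bigr => i _ do rewrite stirling_coef_full !big_distrl /=.
rewrite exchange_big /= big_mkord horner_coef; apply: eq_bigr => k _.
rewrite -natrX (expn_stirling2 _ _ (size f)) // natr_sum big_distrr /= big_mkord.
by apply: eq_bigr => i _; rewrite -bin_ffact !natrM; ring.
Qed.

(** The factor ['C(i, s)] kills the terms with [i < s], so the range no longer depends on [s] and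
    summations can be exchanged. *)
Lemma hcoefSS f s :
  hcoef f s.+2 = \sum_(0 <= i < (size f).-1)
    (-1) ^+ (i - s) * 'C(i, s)%:R * (i.+1`!)%:R * stirling_coef f i.+1.
Proof.
rewrite /hcoef /= big_add1 (@big_nat_widenl _ _ _ s 0) // big_mkcond /=.
apply: eq_bigr => i _; rewrite !subSS subn0; case: leqP => // si.
by rewrite bin_small // !(mulr0, mul0r).
Qed.

Lemma horner_hcoef (f : {poly rat}) (n : nat) :
  f.[n.+1%:R] = \sum_(0 <= s < size f) hcoef f s.+1 * 'C(n + s, s)%:R.
Proof.
have [->|f0] := eqVneq f 0; first by rewrite horner0 size_poly0 big_geq.
rewrite horner_stirling_coef.
have mE : size f = (size f).-1.+1 by rewrite prednK // lt0n size_poly_eq0.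
rewrite mE !big_nat_recl // !bin0 !mulr1; congr (_ + _).
  rewrite stirling_coef_full mE big_nat_recl //= mulr1 big1 ?addr0 // => k _.
  by rewrite mulr0.
under [RHS]eq_bigr => s _ do rewrite hcoefSS big_distrl /=.
rewrite exchange_big /=; apply: eq_big_nat => i im.
(* Newton's expansion contributes ['C(n + 1, i + 1)], which [sum_signed_bin] with [p = 1] spreads
   over the ['C(n + s + 1, s + 1)]. *)
rewrite -(addn1 i) -[n.+1]addn1 -sum_signed_bin big_distrr /=.
rewrite [RHS](@big_cat_nat _ _ _ i.+1) //= [X in _ + X]big_nat_cond.
rewrite [X in _ + X]big1 ?addr0 => [|s /andP[/andP[si _] _]]; last first.
  by rewrite bin_small // !(mulr0, mul0r).
rewrite big_mkord; apply: eq_bigr => s _.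
by rewrite !addn1 addnS; ring.
Qed.

(** * Absolute summability and a ratio test *)

Definition abs_summable {C : numFieldType} (u : C^nat) :=
  exists M : C, forall N, \sum_(0 <= n < N) `|u n| <= M.

Lemma abs_summable0 {C : numFieldType} : abs_summable (fun=> 0 : C).
Proof. by exists 0 => N; rewrite big1 // => i _; rewrite normr0. Qed.

Lemma abs_summableD {C : numFieldType} (u v : C^nat) :
  abs_summable u -> abs_summable v -> abs_summable (fun n => u n + v n).
Proof.
move=> [M uM] [M' vM']; exists (M + M') => N.
apply: le_trans (lerD (uM N) (vM' N)).
by rewrite -big_split; apply: ler_sum => i _; apply: ler_normD.
Qed.

Lemma abs_summable_sum {C : numFieldType} (u : nat -> C^nat) m :
  (forall s, abs_summable (u s)) ->
  abs_summable (fun n => \sum_(0 <= s < m) u s n).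
Proof.
move=> su; elim: m => [|m IH].
  by under [X in abs_summable X]funext => n do rewrite big_geq //;
     exact: abs_summable0.
under [X in abs_summable X]funext => n do rewrite big_nat_recr //=.
exact: abs_summableD.
Qed.

Lemma abs_summable_shift {C : numFieldType} (u : C^nat) :
  abs_summable u -> abs_summable (fun n => u n.+1).
Proof.
move=> [M uM]; exists M => N; apply: le_trans (uM N.+1).
by rewrite big_nat_recl //= lerDr.
Qed.

Lemma abs_summableM_cvg {C : numFieldType} (c u : C^nat) :
  cvgn c -> abs_summable u -> abs_summable (fun n => c n * u n).
Proof.
move=> /cvg_seq_bounded /pinfty_ex_gt0 [K K0 cK] [M uM]; exists (K * M) => N.
apply: le_trans (ler_wpM2l (ltW K0) (uM N)); rewrite big_distrr /=.
apply: ler_sum => i _; rewrite normrM ler_wpM2r //.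
exact: cK.
Qed.

Lemma abs_summableZ {C : numFieldType} (k : C) (u : C^nat) :
  abs_summable u -> abs_summable (fun n => k * u n).
Proof. by move=> su; apply: abs_summableM_cvg => //; exact: is_cvg_cst. Qed.

(** A ratio test with a summable inhomogeneous term. Past some [N] the factor is at most [r < 1] in
    norm, so a tail sum [X] satisfies [X <= |u N| + B + r X] and is bounded. *)
Lemma abs_summable_eventually_contracting {C : numFieldType} (u c b : C^nat)
    (l : C) :
  `|l| < 1 -> c @ \oo --> l -> abs_summable b ->
  (forall n, u n.+1 = c n * u n + b n) -> abs_summable u.
Proof.
move=> l1 cl [B bB] uS.
(* Half the gap below 1, so that [r] is the midpoint of [|l|] and 1, and [1 - r = e]. *)
pose e := (1 - `|l|) / 2.
have e0 : 0 < e by rewrite divr_gt0 // subr_gt0.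
pose r := `|l| + e.
have r1 : 0 < 1 - r.
  suff -> : 1 - r = e by [].
  by rewrite /r /e; field.
have r0 : 0 <= r by rewrite addr_ge0 // ltW.
have [N _ cN] := (cvgrPdist_le _ _).1 cl e e0.
have cr n : (N <= n)%N -> `|c n| <= r.
  move=> Nn; have /= := cN n Nn; rewrite distrC => h.
  by rewrite -(subrK l (c n)) addrC; apply: le_trans (ler_normD _ _) _; rewrite lerD2l.
have B0 : 0 <= B by have := bB 0%N; rewrite big_geq.
have shiftE (F : nat -> C) m :
    \sum_(N <= n < m + N) F n = \sum_(0 <= n < m) F (n + N)%N.
  by rewrite -{1}[N]add0n big_addn addnK.
pose X m := \sum_(0 <= n < m) `|u (n + N)%N|.
have XB m : (1 - r) * X m <= `|u N| + B.
  have XS : X m <= X m.+1 by rewrite /X big_nat_recr //= lerDl.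
  rewrite mulrBl mul1r lerBlDr; apply: le_trans XS _.
  rewrite /X big_nat_recl //= add0n -addrA lerD2l.
  apply: (@le_trans _ _ (\sum_(0 <= n < m) (`|b (n + N)%N| + r * `|u (n + N)%N|))).
    apply: ler_sum => n _; rewrite addSn uS addrC.
    apply: le_trans (ler_normD _ _) _; rewrite lerD2l normrM.
    by rewrite ler_wpM2r // cr // leq_addl.
  rewrite big_split /= -big_distrr /= lerD2r.
  apply: le_trans (bB (m + N)%N).
  rewrite [leRHS](@big_cat_nat _ _ _ N 0) ?leq_addl //=.
  by rewrite shiftE lerDr sumr_ge0.
pose Y := \sum_(0 <= n < N) `|u n|.
exists (Y + (`|u N| + B) / (1 - r)) => m.
apply: (@le_trans _ _ (\sum_(0 <= n < m + N) `|u n|)).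
  by rewrite [leRHS](@big_cat_nat _ _ _ m 0) ?leq_addr //= lerDl sumr_ge0.
rewrite (@big_cat_nat _ _ _ N 0) ?leq_addl //= lerD2l.
rewrite shiftE ler_pdivlMr // mulrC.
exact: XB.
Qed.

(** Compare with a single term within distance 1 of the limit; the slack is harmless, as only some
    uniform bound is wanted. *)
Lemma norm_lim_le {C : numFieldType} (u : C^nat) (l M : C) :
  u @ \oo --> l -> (forall n, `|u n| <= M) -> `|l| <= M + 1.
Proof.
move=> ul uM; have [N _ uN] := (cvgrPdist_le _ _).1 ul 1 ltr01.
rewrite -(subrK (u N) l) addrC; apply: le_trans (ler_normD _ _) _.
by apply: lerD => //; apply: uN => /=.
Qed.

(** Real and imaginary parts are absolutely convergent real series, by monotone convergence; their
    limits assemble into the complex one. *)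
Lemma complex_abs_summable_cvg {R : realType} (u : (complexField R)^nat) :
  abs_summable u -> cvgn (series u).
Proof.
move=> [M uM].
have M0 : 0 <= M by have := uM 0%N; rewrite big_geq.
have main (p : R[i] -> R) : p 0 = 0 -> {morph p : x y / x + y} ->
    (forall x, `|p x|%:C%C <= `|x|) ->
    cvgn (fun n => p (series u n)).
  move=> p0 pD pn.
  have -> : (fun n => p (series u n)) = series (fun n => p (u n)).
    by apply/funext => n; rewrite /series /=; apply: (big_morph p pD p0).
  apply: normed_cvg; apply: nondecreasing_is_cvgn.
    apply/nondecreasing_seqP => n. rewrite /= /series /= /series big_nat_recr //= lerDl.
    exact: normr_ge0.
  exists (complex.Re M) => _ [n _ <-].
  have := uM n; rewrite lecE => /andP[_]; apply: le_trans.
  rewrite -lecR; rewrite RRe_real ?ger0_real ?sumr_ge0 // /series /=.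
  by rewrite rmorph_sum; apply: ler_sum => i _; apply: pn.
have ReD : {morph @complex.Re R : x y / x + y} by move=> [? ?] [? ?].
have ImD : {morph @complex.Im R : x y / x + y} by move=> [? ?] [? ?].
have normc_ge_Im (z : R[i]) : `|complex.Im z|%:C%C <= `|z|.
  by rewrite normc_def lecR -sqrtr_sqr ler_sqrt ?lerDr ?addr_ge0 ?sqr_ge0.
have /cvg_ex[x cx] := main _ erefl ReD (@normc_ge_Re R).
have /cvg_ex[y cy] := main _ erefl ImD normc_ge_Im.
apply/cvg_ex; exists (x +i* y)%C; apply/cvgrPdist_le => e e0.
(* A positive complex [e] is real, so each component can be given half of it. *)
have eE : e = (complex.Re e)%:C%C by rewrite RRe_real ?gtr0_real.
have e20 : 0 < complex.Re e / 2 by rewrite divr_gt0 // -ltcR -eE.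
have := (cvgrPdist_le _ _).1 cx _ e20.
have := (cvgrPdist_le _ _).1 cy _ e20.
move=> [N1 _ h1] [N2 _ h2]; exists (maxn N1 N2) => // n /=.
rewrite geq_max => /andP[/h1 /= ny /h2 /= nx].
set z := series u n in nx ny *.
rewrite [X in `|X|]complexE; apply: le_trans (ler_normD _ _) _.
rewrite eE [leRHS](_ : _ = (complex.Re e / 2)%:C%C + (complex.Re e / 2)%:C%C); last by rewrite -rmorphD -splitr.
have normR (t : R) : `|t%:C%C| = `|t|%:C%C by rewrite normc_def /= expr0n addr0 sqrtr_sqr.
rewrite normrM !normR.
rewrite [`|'i%C|]normc_def /= expr0n add0r expr1n sqrtr1 mul1r.
by case: z nx ny => zx zy nx ny; apply: lerD; rewrite lecR.
Qed.

(** * Power series in the unit disc, assuming that absolutely summable series converge *)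

Section LimitIdentity.
Context {C : numFieldType}.
Context (abs_summable_cvg : forall u : C^nat, abs_summable u -> cvgn (series u)).
Implicit Types (q a z : C) (f : {poly rat}).

Let sub1_neq0 z : `|z| < 1 -> 1 - z != 0.
Proof. by move=> z1; apply: contraTneq z1 => /subr0_eq <-; rewrite normr1 ltxx. Qed.

Let normX_lt1 q n : `|q| < 1 -> `|q ^+ n.+1| < 1.
Proof. by move=> q1; rewrite normrX exprn_ilt1. Qed.

Lemma abs_summable_geometric q : `|q| < 1 -> abs_summable (fun n => q ^+ n).
Proof.
move=> q1; apply: (abs_summable_eventually_contracting _ (cst q) (cst 0) q) => //.
- exact: cvg_cst.
- exact: abs_summable0.
- by move=> n; rewrite exprS addr0.
Qed.

Lemma cvg_exprn_0 q : `|q| < 1 -> (fun n => q ^+ n) @ \oo --> (0 : C).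
Proof. by move=> /abs_summable_geometric/abs_summable_cvg/cvg_series_cvg_0. Qed.

(** By induction on [k]: Pascal's rule makes the sum [s] satisfy [s = z s + l], where [l] is the sum
    for the previous [k], so each stage divides by [1 - z]. *)
Lemma binomial_series z k : `|z| < 1 ->
  abs_summable (fun n => 'C(n + k, k)%:R * z ^+ n) /\
  series (fun n => 'C(n + k, k)%:R * z ^+ n) @ \oo --> (1 - z) ^- k.+1.
Proof.
move=> z1.
have limE (u : C^nat) (w : C^nat) l : abs_summable u ->
    (forall N, series u N.+1 = z * series u N + w N) -> w @ \oo --> l ->
    series u @ \oo --> (1 - z)^-1 * l.
  move=> /abs_summable_cvg /cvg_ex[s us] uS wl.
  suff -> : (1 - z)^-1 * l = s by [].
  have h1 : (fun N => series u N.+1) @ \oo --> s by rewrite cvg_shiftS.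
  have h2 : (fun N => series u N.+1) @ \oo --> z * s + l.
    rewrite (funext uS); apply: cvgD => //.
    by apply: cvgM => //; exact: cvg_cst.
  have := cvg_unique (@norm_hausdorff _ _) h1 h2 => sE.
  apply: (mulfI (sub1_neq0 _ z1)); rewrite mulrA divff ?mul1r ?sub1_neq0 //.
  by rewrite mulrBl mul1r {1}sE; ring.
elim: k => [|k [IH1 IH2]].
  have sz : abs_summable (fun n => 'C(n + 0, 0)%:R * z ^+ n).
    under [X in abs_summable X]funext => n do rewrite bin0 mul1r.
    exact: abs_summable_geometric.
  split => //; rewrite expr1 -[X in _ --> X]mulr1.
  apply: (limE _ (cst 1)) => //; last exact: cvg_cst.
  move=> N; rewrite /series /= big_nat_recl //= bin0 mulr1 addrC big_distrr /=.
  congr (_ + _); apply: eq_bigr => i _; rewrite !bin0 exprS; ring.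
have recE n : 'C(n.+1 + k.+1, k.+1)%:R * z ^+ n.+1 =
    z * ('C(n + k.+1, k.+1)%:R * z ^+ n) + 'C(n.+1 + k, k)%:R * z ^+ n.+1.
  rewrite addSn binS natrD addnS -addSn exprS; ring.
have sz : abs_summable (fun n => 'C(n + k.+1, k.+1)%:R * z ^+ n).
  apply: (abs_summable_eventually_contracting _ (cst z) _ z) recE => //.
    exact: cvg_cst.
  exact: (abs_summable_shift (fun n => 'C(n + k, k)%:R * z ^+ n)).
split => //; rewrite exprS invfM.
apply: (limE _ (fun N => series (fun n => 'C(n + k, k)%:R * z ^+ n) N.+1)) => //; last first.
  by rewrite cvg_shiftS.
move=> N; rewrite /series /= big_nat_recl // [X in _ = _ + X]big_nat_recl //=.
under eq_bigr => i _ do rewrite recE.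
rewrite big_split /= -big_distrr /= !binn; ring.
Qed.

(** Closed form of [G(z)], the generating function of [f(n + 1)]. *)
Definition hcoef_eval f z : C :=
  \sum_(0 <= s < size f) ratr (hcoef f s.+1) * (1 - z) ^- s.+1.

Let polyvalE f n : polyval f n.+1 =
  \sum_(0 <= s < size f) ratr (hcoef f s.+1) * 'C(n + s, s)%:R :> C.
Proof.
rewrite /polyval horner_hcoef rmorph_sum; apply: eq_bigr => s _.
by rewrite rmorphM /= ratr_nat.
Qed.

Lemma cvg_sum_nat m (F : nat -> C^nat) (l : nat -> C) :
  (forall s, F s @ \oo --> l s) ->
  (fun N => \sum_(0 <= s < m) F s N) @ \oo --> \sum_(0 <= s < m) l s.
Proof.
move=> Fl; elim: m => [|m IH].
  rewrite big_geq //; under [X in X @ _]funext => N do rewrite big_geq //.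
  exact: cvg_cst.
rewrite big_nat_recr //=; under [X in X @ _]funext => N do rewrite big_nat_recr //=.
exact: cvgD.
Qed.

Lemma abs_summable_polyval f z : `|z| < 1 ->
  abs_summable (fun n => polyval f n.+1 * z ^+ n).
Proof.
move=> z1.
rewrite (_ : (fun n => _) = fun n => \sum_(0 <= s < size f)
    ratr (hcoef f s.+1) * ('C(n + s, s)%:R * z ^+ n)).
  by apply: abs_summable_sum => s; apply: abs_summableZ; apply: (binomial_series _ _ z1).1.
apply/funext => n; rewrite polyvalE big_distrl /=.
by apply: eq_bigr => s _; rewrite mulrA.
Qed.

Lemma cvg_polyval_series f z : `|z| < 1 ->
  series (fun n => polyval f n.+1 * z ^+ n) @ \oo --> hcoef_eval f z.
Proof.
move=> z1.
rewrite (_ : series _ = fun N => \sum_(0 <= s < size f)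
    ratr (hcoef f s.+1) * series (fun n => 'C(n + s, s)%:R * z ^+ n) N).
  apply: cvg_sum_nat => s; apply: cvgM; first exact: cvg_cst.
  exact: (binomial_series _ _ z1).2.
apply/funext => N; rewrite /series /=.
under [RHS]eq_bigr => s _ do rewrite big_distrr /=.
rewrite exchange_big /=; apply: eq_bigr => n _; rewrite polyvalE big_distrl /=.
by apply: eq_bigr => s _; rewrite mulrA.
Qed.

(** * The generating function of [tseq] and its functional equation *)

Section Recurrence.
Context (q a : C) (f : {poly rat}).
Context (hq : `|q| < 1) (ha : `|a| < 1) (hf : a * polyval f 1 = 0).

Let t n := tseq f a q n.
Let g n : C := polyval f n.+1 - a * polyval f n.+2.

Let aq_neq0 n : 1 - a * q ^+ n != 0.
Proof.
apply: sub1_neq0; rewrite normrM normrX.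
apply: le_lt_trans ha; rewrite ler_piMr // exprn_ile1 // ltW //.
Qed.

Let q_neq0 n : 1 - q ^+ n.+1 != 0.
Proof. by apply: sub1_neq0; exact: normX_lt1. Qed.

Let tS n : (1 - a * q ^+ n.+1) * t n.+1 = g n + (1 - q ^+ n) * t n.
Proof. by rewrite /t /=; rewrite /g; field. Qed.

(** The recurrence multiplies [t n * z ^+ n] by a factor tending to [z] and adds a summable term,
    polynomial times geometric up to a convergent factor. *)
Lemma abs_summable_tseq z : `|z| < 1 -> abs_summable (fun n => t n * z ^+ n).
Proof.
move=> z1.
have cq := cvg_exprn_0 _ hq.
have cqS : (fun n => q ^+ n.+1) @ \oo --> (0 : C) by rewrite (cvg_shiftS (fun n => q ^+ n)).
have cinv : (fun n => (1 - a * q ^+ n.+1)^-1) @ \oo --> (1 : C).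
  rewrite -[X in _ --> X]invr1; apply: cvgV; first exact: oner_neq0.
  rewrite -[X in _ --> X](subr0 1) -[X in _ --> _ - X](mulr0 a).
  by apply: cvgB; [exact: cvg_cst | apply: cvgM => //; exact: cvg_cst].
apply: (abs_summable_eventually_contracting _
  (fun n => z * (1 - q ^+ n) * (1 - a * q ^+ n.+1)^-1)
  (fun n => (1 - a * q ^+ n.+1)^-1 * (g n * z ^+ n.+1)) z) => //.
- rewrite -[X in _ --> X]mulr1; apply: cvgM => //.
  rewrite -[X in _ --> X]mulr1; apply: cvgM => //; first exact: cvg_cst.
  by rewrite -[X in _ --> X](subr0 1); apply: cvgB => //; exact: cvg_cst.
- apply: abs_summableM_cvg; first by apply/cvg_ex; exists 1.
  rewrite (_ : (fun n => _) = fun n => z * (polyval f n.+1 * z ^+ n) +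
     (- a) * (polyval f n.+2 * z ^+ n.+1)).
    apply: abs_summableD; apply: abs_summableZ; first exact: abs_summable_polyval.
    exact: (abs_summable_shift (fun n => polyval f n.+1 * z ^+ n) (abs_summable_polyval f z z1)).
  by apply/funext => n; rewrite /g exprS; ring.
- move=> n; apply: (mulfI (aq_neq0 n.+1)); rewrite [LHS]mulrA tS (exprS z).
  have := aq_neq0 n.+1; set w := 1 - a * _ => w0.
  by field.
Qed.

Let T z : C := limn (series (fun n => t n * z ^+ n)).

Let T_cvg z : `|z| < 1 -> series (fun n => t n * z ^+ n) @ \oo --> T z.
Proof. by move=> /abs_summable_tseq/abs_summable_cvg. Qed.

Let T_functional_eq z : `|z| < 1 ->
  (1 - z) * T z = (a - z) * (T (z * q) - hcoef_eval f z).
Proof.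
move=> z1.
have zq1 : `|z * q| < 1.
  by rewrite normrM; apply: le_lt_trans z1; rewrite ler_piMr // ltW.
have cT := T_cvg _ z1; have cTq := T_cvg _ zq1.
have cG := cvg_polyval_series f _ z1.
pose G N := series (fun n => polyval f n.+1 * z ^+ n) N : C.
pose TN w N := series (fun n => t n * w ^+ n) N.
(* The recurrence times [z ^+ n.+1], summed over [n < N]. The first term of [a * G N.+1] is
   [a f(1) = 0], and [t 0 = 0]. *)
have finE N : TN z N.+1 - a * TN (z * q) N.+1 =
    z * G N - a * G N.+1 + z * (TN z N - TN (z * q) N).
  rewrite /TN /G /series /= !(big_nat_recl N) //= !mul0r !add0r !expr0 mulr1.
  rewrite mulrDr opprD hf oppr0 add0r.
  rewrite !mulrBr !big_distrr /= -!sumrB -big_split /=.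
  apply: eq_bigr => n _.
  transitivity ((1 - a * q ^+ n.+1) * t n.+1 * z ^+ n.+1).
    by rewrite exprMn; ring.
  by rewrite tS /g exprMn exprS; ring.
have lhs : (fun N => TN z N.+1 - a * TN (z * q) N.+1) @ \oo --> T z - a * T (z * q).
  apply: cvgB; first by rewrite (cvg_shiftS (TN z)).
  by apply: cvgM; [exact: cvg_cst | rewrite (cvg_shiftS (TN (z * q)))].
have rhs : (fun N => TN z N.+1 - a * TN (z * q) N.+1) @ \oo -->
    z * hcoef_eval f z - a * hcoef_eval f z + z * (T z - T (z * q)).
  rewrite (funext finE); apply: cvgD; last first.
    by apply: cvgM; [exact: cvg_cst | apply: cvgB].
  apply: cvgB; apply: cvgM; try exact: cvg_cst; first exact: cG.
  by rewrite (cvg_shiftS G).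
have := cvg_unique (@norm_hausdorff _ _) lhs rhs => E.
apply/eqP; rewrite -subr_eq0.
have -> : (1 - z) * T z - (a - z) * (T (z * q) - hcoef_eval f z) =
  (T z - a * T (z * q)) - (z * hcoef_eval f z - a * hcoef_eval f z + z * (T z - T (z * q))) by ring.
by rewrite E subrr.
Qed.

(** * Iteration of the functional equation along the powers of [q] *)

Let W n : C := qpoch_div q a n / qpoch q q n.

Let WS n : W n.+1 = W n * ((a - q ^+ n.+1) / (1 - q ^+ n.+1)).
Proof.
rewrite /W /qpoch_div /qpoch (big_nat_recr n.+1 1) // (big_nat_recr n 0) //= -exprS.
by rewrite invfM mulrACA.
Qed.

(** The functional equation at [q ^+ M.+1] trades [T (q ^+ M.+1)] for [T (q ^+ M.+2)] with exactly
    the factor that takes [W M] to [W M.+1]. *)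
Let W_telescope M :
  T q - W M * T (q ^+ M.+1) = - \sum_(0 <= n < M) W n.+1 * hcoef_eval f (q ^+ n.+1).
Proof.
elim: M => [|M IH].
  by rewrite big_geq // oppr0 /W /qpoch_div /qpoch !big_geq // divr1 mul1r expr1 subrr.
rewrite big_nat_recr //= opprD -IH -addrA; congr (_ + _).
have := T_functional_eq _ (normX_lt1 _ M hq); rewrite -exprSr => E.
have -> : T (q ^+ M.+1) =
    (a - q ^+ M.+1) / (1 - q ^+ M.+1) * (T (q ^+ M.+2) - hcoef_eval f (q ^+ M.+1)).
  by apply: (mulfI (q_neq0 M)); rewrite E mulrA mulrCA divff // mulr1.
rewrite WS; ring.
Qed.

Let P_termE j n : P_term j a q n.+1 = W n.+1 * (1 - q ^+ n.+1) ^- j.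
Proof. by rewrite /P_term /W invfM mulrCA mulrC. Qed.

Let P_partialE j : P_partial j a q = series (fun n => P_term j a q n.+1).
Proof. by apply/funext => N; rewrite /P_partial /series /= big_add1. Qed.

Lemma abs_summable_P_term j : abs_summable (fun n => P_term j a q n.+1).
Proof.
have cq := cvg_exprn_0 _ hq.
have cqS : (fun n => q ^+ n.+1) @ \oo --> (0 : C) by rewrite (cvg_shiftS (fun n => q ^+ n)).
have cqSS : (fun n => q ^+ n.+2) @ \oo --> (0 : C) by rewrite (cvg_shiftS (fun n => q ^+ n.+1)).
have c1 (x : C^nat) : x @ \oo --> (0 : C) -> (fun n => 1 - x n) @ \oo --> (1 : C).
  by move=> x0; rewrite -[X in _ --> X](subr0 1); apply: cvgB => //; exact: cvg_cst.
have cinv : (fun n => (1 - q ^+ n.+2)^-1) @ \oo --> (1 : C).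
  by rewrite -[X in _ --> X]invr1; apply: cvgV; [exact: oner_neq0 | exact: c1].
have cX (x : C^nat) : x @ \oo --> (1 : C) -> (fun n => x n ^+ j) @ \oo --> (1 : C).
  move=> x1; elim: (j) => [|i IH]; first exact: cvg_cst.
  rewrite (_ : (fun n => _) = fun n => x n * x n ^+ i); last first.
    by apply/funext => n; rewrite exprS.
  by rewrite -[X in _ --> X]mulr1; apply: cvgM.
(* The factor from one term to the next tends to [a], and [|a| < 1]. *)
apply: (abs_summable_eventually_contracting _
  (fun n => (a - q ^+ n.+2) * (1 - q ^+ n.+2)^-1 *
     ((1 - q ^+ n.+1) * (1 - q ^+ n.+2)^-1) ^+ j) (cst 0) a) => //.
- rewrite -[X in _ --> X]mulr1; apply: cvgM.
    rewrite -[X in _ --> X]mulr1; apply: cvgM => //.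
    by rewrite -[X in _ --> X](subr0 a); apply: cvgB => //; exact: cvg_cst.
  by apply: cX; rewrite -[X in _ --> X]mulr1; apply: cvgM; [exact: c1 | exact: cinv].
- exact: abs_summable0.
- move=> n; rewrite addr0 !P_termE WS exprMn exprVn.
  have := expf_neq0 j (q_neq0 n); set U := _ ^+ j => U0.
  by rewrite -[LHS]mul1r -(divff U0); ring.
Qed.

Lemma cvg_P_partial j : cvgn (P_partial j a q).
Proof. by rewrite P_partialE; apply: abs_summable_cvg; exact: abs_summable_P_term. Qed.

(** [W n.+1] is the general term of the convergent series with [j = 0], while [T (q ^+ M.+1)] is
    bounded in [M] by the absolute sum at [q]. *)
Let W_T_cvg0 : (fun M => W M * T (q ^+ M.+1)) @ \oo --> (0 : C).
Proof.
have W0 : W @ \oo --> (0 : C).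
  rewrite -cvg_shiftS.
  rewrite (_ : [sequence W n.+1]_n = fun n => P_term 0 a q n.+1).
    exact: cvg_series_cvg_0 (abs_summable_cvg _ (abs_summable_P_term 0)).
  by apply/funext => n; rewrite P_termE expr0 invr1 mulr1.
have [B tB] := abs_summable_tseq _ hq.
have TB M : `|T (q ^+ M.+1)| <= B + 1.
  apply: (norm_lim_le _ _ _ (T_cvg _ (normX_lt1 _ M hq))) => N.
  apply: le_trans (tB N); apply: le_trans (ler_norm_sum _ _ _) _.
  apply: ler_sum => n _; rewrite !normrM ler_wpM2l // -exprM mulnC exprM.
  by rewrite normrX exprSr ler_piMl // exprn_ile1 ?normr_ge0 // normrX exprn_ile1 // ltW.
have B0 : 0 < B + 1.
  by apply: ltr_wpDl => //; have := tB 0%N; rewrite big_geq.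
apply/cvgrPdist_le => e e0.
have [N _ WN] := (cvgrPdist_le _ _).1 W0 _ (divr_gt0 e0 B0).
exists N => // n /WN /=; rewrite !sub0r !normrN => Wn.
rewrite normrM -[leRHS](divfK (lt0r_neq0 B0)).
by apply: ler_pM.
Qed.

(** * Identification of [T q] with the sum of the [h_j P_j] and with the limit of the corrected
    sums *)

Lemma series_tseq_P_fun :
  T q = \sum_(0 <= s < size f) ratr (hcoef f s.+1) * P_fun s.+1 a q.
Proof.
have c1 : (fun M => T q - W M * T (q ^+ M.+1)) @ \oo --> T q.
  rewrite -[X in _ --> X]subr0; apply: cvgB => //; exact: cvg_cst.
have c2 : (fun M => T q - W M * T (q ^+ M.+1)) @ \oo -->
    \sum_(0 <= s < size f) ratr (hcoef f s.+1) * P_fun s.+1 a q.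
  (* Telescoping, then exchanging two finite sums, turns the same sequence into a combination of the
     [P_partial]. *)
  rewrite (_ : (fun M => _) = fun M => \sum_(0 <= s < size f)
      ratr (hcoef f s.+1) * (- P_partial s.+1 a q M)); last first.
    apply/funext => M; rewrite W_telescope.
    under [RHS]eq_bigr => s _ do rewrite P_partialE /series /= mulrN big_distrr /=.
    rewrite sumrN exchange_big /=; congr (- _); apply: eq_bigr => n _.
    rewrite /hcoef_eval big_distrr /=; apply: eq_bigr => s _.
    by rewrite P_termE mulrCA.
  apply: cvg_sum_nat => s; apply: cvgM; first exact: cvg_cst.
  by apply: cvgN; exact: cvg_P_partial.
exact: (cvg_unique (@norm_hausdorff _ _) c1 c2).
Qed.

Lemma hP_partialE N : (size f <= N)%N ->
  hP_partial f a q N = \sum_(0 <= s < size f) ratr (hcoef f s.+1) * P_fun s.+1 a q.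
Proof.
move=> fN; rewrite /hP_partial big_add1 /= (@big_cat_nat _ _ _ (size f)) //=.
rewrite [X in _ + X]big_nat_cond [X in _ + X]big1 ?addr0 //.
(* Beyond [size f] the sum defining [h_j] is empty; the index [j = 1] occurs here only when
   [f = 0]. *)
move=> [|s] /andP[/andP[fs _] _]; last first.
  by rewrite /hcoef /= big_geq // raddf0 mul0r.
by rewrite /hcoef /= nth_default // raddf0 mul0r.
Qed.

Lemma cvg_hP_partial :
  hP_partial f a q @ \oo --> \sum_(0 <= s < size f) ratr (hcoef f s.+1) * P_fun s.+1 a q.
Proof. by apply: cvg_near_cst; exists (size f) => // N /= fN; exact: hP_partialE. Qed.

(** Exact for every [l]: by the recurrence all values of [f] cancel in the increment from [l] to
    [l + 1], leaving [t l * q ^+ l]. The case [l = 0] is [a f(1) = 0]. *)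
Lemma corrected_sum_series l :
  \sum_(1 <= n < l.+1) polyval f n - a / (1 - a) * polyval f l.+1
    - (1 - a * q ^+ l) / (1 - a) * tseq f a q l
  = series (fun n => t n * q ^+ n) l.
Proof.
have a1 := sub1_neq0 _ ha.
elim: l => [|l IH].
  rewrite /series /= !big_geq // mulr0 subr0 sub0r mulrAC hf mul0r oppr0 //.
rewrite [RHS](_ : _ = series (fun n => t n * q ^+ n) l + t l * q ^+ l); last first.
  by rewrite /series /= big_nat_recr.
rewrite -IH (big_nat_recr l.+1) // -/(t l) -/(t l.+1).
rewrite [(_ / _ * t l.+1)]mulrAC tS /g /=.
by field.
Qed.

Lemma cvg_corrected_sum :
  (fun l => \sum_(1 <= n < l.+1) polyval f n - a / (1 - a) * polyval f l.+1
    - (1 - a * q ^+ l) / (1 - a) * tseq f a q l) @ \oo --> limn (hP_partial f a q).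
Proof.
rewrite (cvg_lim (@norm_hausdorff _ _) cvg_hP_partial) -series_tseq_P_fun.
by rewrite (funext corrected_sum_series); exact: T_cvg.
Qed.

End Recurrence.
End LimitIdentity.

Theorem theorem3p2 (R : realType) (q a : complexField R) (f : {poly rat})
    (hq : `|q| < 1) (ha : `|a| < 1) (hf : a * polyval f 1 = 0) :
  [/\ forall j : nat, (1 <= j)%N -> cvgn (P_partial j a q),
      cvgn (hP_partial f a q)
    & (fun l : nat =>
         \sum_(1 <= n < l.+1) polyval f n
         - a / (1 - a) * polyval f l.+1
         - (1 - a * q ^+ l) / (1 - a) * tseq f a q l)
        @ \oo --> limn (hP_partial f a q)].
Proof.
have cplt := @complex_abs_summable_cvg R.
split=> [j _||].
- exact: cvg_P_partial.
- by apply/cvg_ex; eexists; exact: cvg_hP_partial.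
- exact: cvg_corrected_sum.
Qed.
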